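(* Let $G$ be a finite nonabelian CA-group whose non-central elements lie in $b$ maximal abelian subgroups (that is, $b$ is the number of maximal abelian subgroups of $G$). Then the commuting difference lattice $M_{\mathrm{comm}}(G)$ has a single nontrivial Smith invariant factor, equal to $b-1$, so $$C_{\mathrm{comm}}(G)=\operatorname{rad}(b-1).$$
   Context: A finite group $G$ is a CA-group if the centralizer of every non-central element is abelian; equivalently, the non-central elements of $G$ are partitioned by the maximal abelian subgroups of $G$ (with the center removed), and distinct maximal abelian subgroups meet exactly in $Z(G)$. Commuting difference lattice: let $P$ be the $G\times G$ zero-one matrix with $P_{g,h}=1$ if $gh=hg$ and $P_{g,h}=0$ otherwise. Then $M_{\mathrm{comm}}(G)\subseteq\mathbb{Z}^{G}$ is the $\mathbb{Z}$-span of all differences of rows $P_g-P_{g'}$, $g,g'\in G$. The invariant factors of a lattice $M\subseteq\mathbb{Z}^N$ are the nonzero Smith normal form entries $d_1\mid d_2\mid\cdots\mid d_r$ of any integer matrix whose rows generate $M$ ($r$ the rank of $M$); the nontrivial ones are those greater than $1$. The commuting conductor is the set of primes $C_{\mathrm{comm}}(G)=\{p \text{ prime}:\operatorname{rank}_{\mathbb{F}_p}(M_{\mathrm{comm}}(G)\bmod p)<\operatorname{rank}_{\mathbb{Q}}M_{\mathrm{comm}}(G)\}$, where $M\bmod p$ is the image of $M$ in $\mathbb{F}_p^{N}$ (row space mod $p$ of a generating matrix). For a positive integer $n$, $\operatorname{rad}(n)$ denotes the set of primes dividing $n$. *)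

(* Defs.v *)
From HB Require Import structures.
From mathcomp Require Import all_boot all_order all_algebra all_fingroup all_solvable.

Set Implicit Arguments.
Unset Strict Implicit.
Unset Printing Implicit Defensive.

Import Order.TTheory GRing.Theory Num.Theory.

Local Open Scope ring_scope.

Section Lattices.

Variable N : nat.
Implicit Types (M : 'rV[int]_N -> Prop) (d : seq nat).

Definition rows_generate m (A : 'M[int]_(m, N)) M : Prop :=
  forall v, M v <-> inIntSpan [tuple row i A | i < m] v.

(* [d] lists only the nonzero Smith entries, so it must fit on the diagonal
   (the size bounds): otherwise its tail would be unconstrained. *)
Definition smith_entries m (A : 'M[int]_(m, N)) d : Prop :=
  [/\ (size d <= minn m N)%N, all (leq 1) d, sorted dvdn d &
      exists2 L : 'M[int]_m, L \in unitmx &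
      exists2 R : 'M[int]_N, R \in unitmx &
        A = L *m (\matrix_(i, j) ((nth 0%N d i)%:Z *+ (i == j :> nat))) *m R].

Definition invariant_factors M d : Prop :=
  exists m (A : 'M[int]_(m, N)), rows_generate A M /\ smith_entries A d.

Definition nontrivial_factors d : seq nat := [seq x <- d | (1 < x)%N].

Definition conductor M (p : nat) : Prop :=
  prime p /\
  exists m (A : 'M[int]_(m, N)), rows_generate A M /\
    (\rank (map_mx intr A : 'M['F_p]_(m, N))
       < \rank (map_mx intr A : 'M[rat]_(m, N)))%N.

End Lattices.

Section Commuting.

Variables (gT : finGroupType) (G : {group gT}).

Definition CA_group : bool :=
  [forall x in G :\: 'Z(G)%g, abelian 'C_G[x]%g].

Definition max_abelian_subgroups : {set {group gT}} :=
  [set A : {group gT} | [max A of H | (H \subset G) && abelian H]%g].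

(* Elements of G are indexed by 'I_#|G| through enum_val, so Z^G is
   'rV[int]_#|G|. *)
Definition commuting_mx : 'M[int]_#|G| :=
  \matrix_(i, j)
    ((enum_val i * enum_val j)%g == (enum_val j * enum_val i)%g)%:R.

Definition comm_diff_lattice : 'rV[int]_#|G| -> Prop :=
  inIntSpan [tuple of codom (fun gh : 'I_#|G| * 'I_#|G| =>
                               row gh.1 commuting_mx - row gh.2 commuting_mx)].

Definition comm_conductor : nat -> Prop := conductor comm_diff_lattice.

End Commuting.

Arguments comm_diff_lattice {gT} G _.

(* Main.v *)
Require Import Defs.
From HB Require Import structures.
From mathcomp Require Import all_boot all_order all_algebra all_fingroup all_solvable.

Set Implicit Arguments.
Unset Strict Implicit.
Unset Printing Implicit Defensive.

Import Order.TTheory GRing.Theory Num.Theory.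
Local Open Scope ring_scope.

(** The row of the commuting matrix at a central element is the all-ones row.
    In a CA-group the centralizer of a non-central [x] is the unique maximal
    abelian subgroup containing [x], so the row at [x] is the indicator of that
    subgroup, and two such subgroups meet exactly in the center.  Hence with
    [e_1, ..., e_b] the indicators of the [b] classes of commuting non-central
    elements, the difference lattice is spanned by the vectors [e_i - e_j] and
    [\sum_(j != i) e_j], that is, it consists of the [\sum_i x_i e_i] for which
    [b - 1] divides [\sum_i x_i] ([transversal_spanP]).

    So the lattice is the part of a pure sublattice [S] on which an integral
    linear form [phi], taking the value 1, is divisible by [n = b - 1]; the
    quotient of [S] by it is cyclic of order [n].  This determines the Smith
    entries ([cyclic_quotient_smith]): the last one is the exponent of the
    quotient, namely [n], and all others are 1 since the quotient is cyclic.  As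
    [b > 2] for a nonabelian group ([CA_three_centralizers]), [n] is a
    nontrivial factor.

    Over any field the rank of a matrix is the number of its Smith entries that
    are nonzero there ([rank_smith]).  With entries [1, ..., 1, n], the rank
    modulo [p] is smaller than the rational rank exactly when [p] divides
    [n]. *)

(** * Smith forms of lattices *)

Local Notation smith_diag m N d :=
  (\matrix_(i < m, j < N) ((nth 0%N d i)%:Z *+ (i == j :> nat))).

Lemma inIntSpan_tuple (V : zmodType) m (t : m.-tuple V) v :
  inIntSpan t v <-> exists a : 'I_m -> int, v = \sum_i tnth t i *~ a i.
Proof.
split=> [[a ->] | [a ->]].
  by exists a; apply: eq_bigr => i _; rewrite (tnth_nth 0).
by exists (finfun a); apply: eq_bigr => i _; rewrite ffunE (tnth_nth 0).
Qed.

Lemma inIntSpan_rows m N (A : 'M[int]_(m, N)) v :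
  inIntSpan [tuple row i A | i < m] v <-> exists u : 'rV_m, v = u *m A.
Proof.
apply: (iff_trans (inIntSpan_tuple _ _)); split=> [[a ->] | [u ->]].
  exists (\row_i a i); rewrite mulmx_sum_row; apply: eq_bigr => i _.
  by rewrite tnth_mktuple mxE -scaler_int intz.
exists (u 0); rewrite mulmx_sum_row; apply: eq_bigr => i _.
by rewrite tnth_mktuple -scaler_int intz.
Qed.

Lemma rows_generate_inIntSpan N m (t : m.-tuple 'rV[int]_N) :
  rows_generate (\matrix_(i < m) tnth t i) (inIntSpan t).
Proof.
move=> v; suff <- : t = [tuple row i (\matrix_(i < m) tnth t i) | i < m] by [].
by apply: eq_from_tnth => i; rewrite tnth_mktuple rowK.
Qed.

Lemma dvdn_sorted_nth d i j :
  sorted dvdn d -> (i <= j)%N -> (j < size d)%N -> (nth 0 d i %| nth 0 d j)%N.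
Proof.
move=> sd ij jd; have id := leq_ltn_trans ij jd.
by apply: (sorted_leq_nth dvdn_trans dvdnn) => //; rewrite inE.
Qed.

(** In the basis formed by the rows of the right-hand Smith multiplier, a
    lattice is cut out by one divisibility condition per coordinate.  Reading
    [nth 0 d j] as 0 past the end of [d] forces those coordinates to vanish. *)
Lemma smith_coordP m N (A : 'M[int]_(m, N)) M d L R :
  rows_generate A M -> L \in unitmx -> R \in unitmx -> (size d <= minn m N)%N ->
  A = L *m smith_diag m N d *m R ->
  forall v, M v <-> forall j, ((nth 0%N d j)%:Z %| (v *m invmx R) 0%R j)%Z.
Proof.
move=> genA uL uR; rewrite leq_min => /andP[dm _] defA v.
have diagE (u : 'rV[int]_m) j : (u *m smith_diag m N d) 0 j =
    (if insub (val j) is Some i then u 0 i else 0) * (nth 0%N d j)%:Z.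
  rewrite mxE; case: insubP => [i _ ij | ]; last first.
    rewrite -leqNgt => mj; rewrite mul0r big1 // => i _; rewrite mxE.
    by rewrite ltn_eqF ?mulr0n ?mulr0 // (leq_trans (ltn_ord i)).
  rewrite (bigD1 i) //= big1 ?addr0 => [|k ki]; rewrite mxE.
    by rewrite -ij eqxx mulr1n.
  by rewrite -ij (inj_eq val_inj) (negPf ki) mulr0n mulr0.
apply: (iff_trans (genA v)); apply: (iff_trans (inIntSpan_rows _ _)).
split=> [[u ->] j | dvd].
  by rewrite defA mulmxA mulmxK // mulmxA diagE dvdz_mull.
pose w := v *m invmx R.
pose u : 'rV[int]_m :=
  \row_i (if insub (val i) is Some j then (w 0%R j %/ (nth 0%N d i)%:Z)%Z else 0).
(* Past the end of [d] the quotient is by 0, but there the coordinate of [w]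
   is 0 as well. *)
exists (u *m invmx L); rewrite defA !mulmxA mulmxKV // -[LHS](mulmxKV uR) -/w.
congr (_ *m R); apply/rowP => j; rewrite diagE.
case: insubP => [i _ ij | ]; last first.
  rewrite -leqNgt => mj; rewrite mul0r.
  by move: (dvd j); rewrite nth_default ?dvd0z -/w => [/eqP|]; last exact: leq_trans mj.
by rewrite [u 0 i]mxE ij valK /= [nat_of_ord i]ij divzK //; apply: dvd.
Qed.

(** The absolute values of the entries given by [int_Smith_normal_form] form a
    divisibility chain; its zeros are therefore at the end, and the signs are
    units that move into the left-hand multiplier. *)
Lemma smith_entries_exist m N (A : 'M[int]_(m, N)) :
  exists d, smith_entries A d.
Proof.
have [L uL [R uR [d0 sd0 defA]]] := int_Smith_normal_form A.
pose s := [seq absz x | x <- take (minn m N) d0].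
have ss : sorted dvdn s.
  by rewrite sorted_map; apply: sub_sorted (take_sorted _ sd0) => x y /=.
have zero_tail i : (find (pred1 0%N) s <= i)%N -> nth 0%N s i = 0%N.
  move=> fi; have [si|] := ltnP i (size s); last exact: nth_default.
  have fs := leq_ltn_trans fi si.
  apply/eqP; rewrite -dvd0n; move: (dvdn_sorted_nth ss fi si).
  by have /eqP -> : pred1 0%N (nth 0%N s (find (pred1 0%N) s))
    by apply: nth_find; rewrite has_find.
pose d := take (find (pred1 0%N) s) s.
have dE i : nth 0%N d i = nth 0%N s i.
  have [fi|fi] := ltnP i (find (pred1 0%N) s); first by rewrite nth_take.
  by rewrite zero_tail // nth_default // size_takel // find_size.
exists d; split.
- rewrite size_takel ?find_size // (leq_trans (find_size _ _)) //.
  by rewrite size_map size_take; case: ltnP => // /ltnW.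
- apply/(all_nthP 0%N) => i; rewrite size_takel ?find_size // => fi.
  by rewrite dE lt0n; have /= -> := before_find 0%N fi.
- exact: take_sorted.
pose S : 'rV[int]_m := \row_i (if d0`_i < 0 then -1 else 1).
have uS : diag_mx S \in unitmx.
  rewrite unitmxE det_diag rpred_prod // => i _; rewrite mxE.
  by case: ifP => _; rewrite ?unitrN unitr1.
exists (L *m diag_mx S); first by rewrite unitmx_mul uL.
exists R => //; rewrite defA; congr (_ *m R); rewrite -mulmxA; congr (_ *m _).
apply/matrixP => i j; rewrite mul_diag_mx !mxE.
have [ij|_] := eqVneq (i : nat) j; last by rewrite !mulr0n mulr0.
have im : (i < minn m N)%N by rewrite leq_min ltn_ord ij ltn_ord.
rewrite !mulr1n dE /s; have [id|id] := ltnP i (size d0); last first.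
  by rewrite !nth_default ?size_map ?size_take ?mulr0 // geq_min id orbT.
rewrite (nth_map 0) ?size_take ?nth_take //; last by case: ifP.
rewrite abszE; case: ltrP => [neg|pos]; last by rewrite ger0_norm // mul1r.
by rewrite ltr0_norm // mulN1r opprK.
Qed.

(** Scaling the rows by units turns the matrix into a partial identity. *)
Lemma rank_prefix_diag (F : fieldType) m N k (s : nat -> F) :
  (k <= m)%N -> (k <= N)%N -> (forall i, (s i != 0) = (i < k)%N) ->
  \rank (\matrix_(i < m, j < N) (s i *+ (i == j :> nat))) = k.
Proof.
move=> km kN sP; pose u := \row_(i < m) (if (i < k)%N then s i else 1).
have uu : diag_mx u \in unitmx.
  rewrite unitmxE det_diag unitfE; apply/prodf_neq0 => i _; rewrite mxE.
  by case: ifP => ik; rewrite ?oner_eq0 // sP.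
rewrite -[RHS](rank_pid_mx F km kN).
rewrite -(eqmxMfull (pid_mx k : 'M[F]_(m, N)) (_ : row_full (diag_mx u)));
  last by rewrite row_full_unit.
congr (\rank _); apply/matrixP => i j; rewrite mul_diag_mx !mxE.
case: eqP => //= ij; last by rewrite mulr0.
case: ltnP => ik; rewrite /= ?mulr1 //.
by rewrite mulr0 mulr1n; apply/eqP/negbNE; rewrite sP -leqNgt.
Qed.

(** The quotient of [S] by [M] is cyclic of order [n], generated by the class of
    [e].  Purity puts each basis row [R_j] with [d_j != 0] in [S], where [d_j] is
    the order of the class of [R_j].  All these orders divide [n]; since
    [e] is a combination of these rows, the last order kills the class of [e],
    so it is [n].  For
    an earlier row, [phi R_j *: R_l - phi R_l *: R_j] is in the kernel of [phi],
    hence in [M]; its coordinate at the last row [R_l] shows that [n] divides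
    [phi R_j], so that already [R_j] is in [M] and [d_j = 1]. *)
Lemma cyclic_quotient_smith N (M : 'rV[int]_N -> Prop) (S : {pred 'rV[int]_N})
    (phi : {scalar 'rV[int]_N}) (n : nat) (e : 'rV[int]_N) :
    submod_closed S -> (forall k v, k != 0 -> k *: v \in S -> v \in S) ->
    e \in S -> phi e = 1 -> (0 < n)%N ->
    (forall v, M v <-> v \in S /\ (n %| phi v)%Z) ->
  forall m (A : 'M[int]_(m, N)) d, rows_generate A M -> smith_entries A d ->
  exists r, d = rcons (nseq r 1%N) n.
Proof.
move=> [S0 linS] pureS Se phi_e n_gt0 defM m A d genA.
case=> dmN d_gt0 sd [L uL [R uR defA]].
have coordP := smith_coordP genA uL uR dmN defA.
have scaleS k v : v \in S -> k *: v \in S.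
  by move=> Sv; rewrite -[_ *: v]addr0 linS.
have rowRP j k : (row j R *m invmx R) 0 k = (j == k)%:R.
  by rewrite -row_mul mulmxV // !mxE.
have M_rowR k j : M (k *: row j R) -> ((nth 0%N d j)%:Z %| k)%Z.
  by move/coordP/(_ j); rewrite -scalemxAl mxE rowRP eqxx mulr1.
have S_rowR (j : 'I_N) : (j < size d)%N -> row j R \in S.
  move=> jd; apply: (pureS (nth 0%N d j)%:Z).
    by rewrite eqz_nat -lt0n; apply: (all_nthP 0%N d_gt0).
  suff /defM[] : M ((nth 0%N d j)%:Z *: row j R) by [].
  apply/coordP => k; rewrite -scalemxAl mxE rowRP.
  by have [->|_] := eqVneq j k; rewrite ?mulr1 ?mulr0 ?dvdz0.
have M_n v : v \in S -> M (n%:Z *: v).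
  by move=> Sv; apply/defM; rewrite scaleS // scalarZ dvdz_mulr.
have dN : (size d <= N)%N by move: dmN; rewrite leq_min => /andP[].
case/lastP: d => [|d x] in dmN dN d_gt0 sd defA coordP M_rowR S_rowR *.
  have := M_n e Se; move/coordP => e0; exfalso.
  suff n0 : n%:Z *: e = 0.
    have := scalarZ phi n%:Z e; rewrite n0 linear0 phi_e /= mulr1 => -[] n00.
    by rewrite -n00 in n_gt0.
  rewrite -[LHS](mulmxKV uR); suff -> : n%:Z *: e *m invmx R = 0 by rewrite mul0mx.
  by apply/rowP => j; move: (e0 j); rewrite nth_nil dvd0z [RHS]mxE => /eqP.
rewrite size_rcons in dN; pose l := Ordinal dN.
have nth_l : nth 0%N (rcons d x) l = x by rewrite nth_rcons ltnn eqxx.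
have S_l : row l R \in S by rewrite S_rowR // size_rcons /=.
have x_eq_n : x = n.
  apply/eqP; rewrite eqn_dvd; apply/andP; split.
    by have := M_rowR n%:Z l (M_n _ S_l); rewrite nth_l.
  have /defM[_] : M (x%:Z *: e).
    apply/coordP => j; rewrite -scalemxAl mxE.
    have [jx|xj] := ltnP j (size (rcons d x)).
      rewrite dvdz_mulr // -[x in X in (_ %| X)%Z]nth_l.
      by apply: dvdn_sorted_nth; rewrite ?size_rcons //= -ltnS -(size_rcons d x).
    have /coordP/(_ j) := M_n e Se.
    rewrite nth_default // !dvd0z -scalemxAl mxE mulf_eq0 eqz_nat.
    by rewrite eqn0Ngt n_gt0 /= => /eqP ->; rewrite mulr0.
  by rewrite scalarZ /= phi_e mulr1.
subst x; exists (size d); congr (rcons _ n); apply/all_pred1P/(all_nthP 0%N).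
move=> i id /=; pose j := Ordinal (ltn_trans id dN).
have S_j : row j R \in S by rewrite S_rowR // size_rcons /= ltnS ltnW.
have jl : (j == l) = false by rewrite -val_eqE /= ltn_eqF.
have /coordP/(_ l) :
    M (phi (row j R) *: row l R + - phi (row l R) *: row j R).
  apply/defM; split; first by rewrite linS ?scaleS.
  by rewrite scalarP scalarZ /= mulNr mulrC subrr dvdz0.
rewrite mulmxDl -!scalemxAl -!row_mul mulmxV // !mxE eqxx jl mulr1 mulr0 addr0 nth_l.
move=> n_phi.
have := M_rowR 1 j; rewrite scale1r dvdz1 /= nth_rcons id => d1.
by apply/d1/defM.
Qed.

(** Stated with a threshold [k]: by divisibility the entries that vanish in [F]
    come last. *)
Lemma rank_smith (F : fieldType) m N (A : 'M[int]_(m, N)) d k :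
    smith_entries A d ->
    (forall i, ((nth 0%N d i)%:R != 0 :> F) = (i < k)%N) ->
  \rank (map_mx intr A : 'M[F]_(m, N)) = k.
Proof.
case=> dmN _ _ [L uL [R uR ->]] dk.
have kd : (k <= size d)%N by rewrite leqNgt -dk nth_default ?eqxx.
have [km kN] : (k <= m)%N /\ (k <= N)%N.
  by apply/andP; rewrite -leq_min (leq_trans kd).
have unitF n (U : 'M[int]_n) : U \in unitmx -> map_mx intr U \in @unitmx F n.
  by rewrite !unitmxE det_map_mx; apply: rmorph_unit.
rewrite !map_mxM mxrankMfree ?row_free_unit ?unitF //.
rewrite eqmxMfull ?row_full_unit ?unitF //.
apply: etrans (rank_prefix_diag km kN dk).
congr (\rank _); apply/matrixP => i j; rewrite !mxE.
by case: eqP => _; rewrite ?mulr0n ?mulr1n ?rmorph0 // -pmulrn.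
Qed.

Lemma conductor_one_factor N (M : 'rV[int]_N -> Prop) (n : nat) :
    (0 < n)%N -> (exists m (A : 'M[int]_(m, N)), rows_generate A M) ->
    (forall m (A : 'M[int]_(m, N)) d, rows_generate A M -> smith_entries A d ->
       exists r, d = rcons (nseq r 1%N) n) ->
  forall p, conductor M p <-> p \in \pi(n).
Proof.
move=> n_gt0 [m0 [A0 genA0]] smithM p.
have rankM (F : fieldType) m (A : 'M[int]_(m, N)) r :
    smith_entries A (rcons (nseq r 1%N) n) ->
    \rank (map_mx intr A : 'M[F]_(m, N)) = (r + (n%:R != 0%R :> F))%N.
  move=> smithA; apply: (rank_smith smithA) => i.
  rewrite nth_rcons size_nseq nth_nseq.
  case: ltngtP => [ir|ri|->].
  - by rewrite (ltn_addr _ ir); apply: oner_neq0.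
  - rewrite eqxx; apply/esym/negbTE; rewrite -leqNgt (leq_trans _ ri) //.
    by rewrite -addn1 leq_add2l leq_b1.
  - by rewrite -[X in (X < _)%N]addn0 ltn_add2l lt0b.
have rank_lt m (A : 'M[int]_(m, N)) : prime p -> rows_generate A M ->
    (\rank (map_mx intr A : 'M['F_p]_(m, N))
       < \rank (map_mx intr A : 'M[rat]_(m, N)))%N = (p %| n)%N.
  move=> p_pr genA; have [d smithA] := smith_entries_exist A.
  have [r dE] := smithM _ _ _ genA smithA; rewrite dE in smithA.
  rewrite !(rankM _ _ _ r smithA) ltn_add2l pnatr_eq0 -lt0n n_gt0.
  by rewrite -(dvdn_pcharf (pchar_Fp p_pr)) ltnS leqn0 eqb0 negbK.
rewrite mem_primes n_gt0 /=; split=> [[p_pr [m [A [genA]]]] | /andP[p_pr pn]].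
  by rewrite p_pr rank_lt.
by split=> //; exists m0, A0; split; rewrite ?rank_lt.
Qed.

(** * Row differences of a commuting matrix *)

Lemma inIntSpan0 (V : zmodType) m (t : m.-tuple V) : inIntSpan t 0.
Proof.
by apply/inIntSpan_tuple; exists (fun=> 0); rewrite big1 // => i; rewrite mulr0z.
Qed.

Lemma inIntSpanD (V : zmodType) m (t : m.-tuple V) u v :
  inIntSpan t u -> inIntSpan t v -> inIntSpan t (u + v).
Proof.
move=> /inIntSpan_tuple[a ->] /inIntSpan_tuple[b ->]; apply/inIntSpan_tuple.
exists (fun i => a i + b i); rewrite -big_split.
by apply: eq_bigr => i _; rewrite mulrzDr.
Qed.

Lemma inIntSpan_mulz (V : zmodType) m (t : m.-tuple V) v k :
  v \in t -> inIntSpan t (v *~ k).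
Proof.
case/tnthP=> i ->; apply/inIntSpan_tuple; exists (fun j => if j == i then k else 0).
rewrite (bigD1 i) //= eqxx big1 ?addr0 // => j /negPf ->.
by rewrite mulr0z.
Qed.

Definition coord_sum N (X : {set 'I_N}) (v : 'rV[int]_N) : int :=
  \sum_(x in X) v 0 x.

Fact coord_sum_is_scalar N (X : {set 'I_N}) : scalar (coord_sum X).
Proof.
move=> a u v; rewrite /coord_sum mulr_sumr -big_split.
by apply: eq_bigr => x _; rewrite !mxE.
Qed.

HB.instance Definition _ N (X : {set 'I_N}) :=
  GRing.isLinear.Build int 'rV[int]_N int *%R (coord_sum X)
    (coord_sum_is_scalar X).

(** With [nc] the set of non-central indices and [rep] sending each of them to
    the representative of its class, these are the rows that vanish on the
    central indices and are constant on each class. *)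
Definition class_rows N (nc : pred 'I_N) (rep : 'I_N -> 'I_N) :
    {pred 'rV[int]_N} :=
  [pred v : 'rV[int]_N | v == \row_i (if nc i then v 0 (rep i) else 0)].

Lemma class_rowsP N (nc : pred 'I_N) rep (v : 'rV[int]_N) :
  reflect (forall i, v 0 i = if nc i then v 0 (rep i) else 0)
          (v \in class_rows nc rep).
Proof.
apply: (iffP eqP) => [{1}-> i | vE]; first by rewrite mxE.
by apply/rowP => i; rewrite mxE.
Qed.

Lemma class_rows_submod N (nc : pred 'I_N) rep : submod_closed (class_rows nc rep).
Proof.
split=> [|a u v /class_rowsP uE /class_rowsP vE]; apply/class_rowsP => i.
  by rewrite !mxE if_same.
by rewrite !mxE uE vE; case: ifP => // _; rewrite mulr0 addr0.
Qed.

Lemma class_rows_pure N (nc : pred 'I_N) rep (k : int) v :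
  k != 0 -> k *: v \in class_rows nc rep -> v \in class_rows nc rep.
Proof.
move=> k0 /class_rowsP vE; apply/class_rowsP => i; apply: (mulfI k0).
by move: (vE i); rewrite !mxE => ->; case: ifP => // _; rewrite mulr0.
Qed.

(** Only the combinatorics of the commuting relation [c] matters: [i0] is a
    central index, and [X] contains exactly one index from each class of
    non-central ones.  That indices of one class have the same neighbours
    ([c_rep]) is what the CA property provides. *)
Section Transversal.

Variables (N : nat) (c : rel 'I_N) (i0 : 'I_N) (X : {set 'I_N}).
Variable rep : 'I_N -> 'I_N.

Let nc i := ~~ [forall j, c j i].
Let C : 'M[int]_N := \matrix_(i, j) (c i j)%:R.
Let diffs := [tuple of codom (fun gh : 'I_N * 'I_N => row gh.1 C - row gh.2 C)].

Hypothesis c_sym : symmetric c.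
Hypothesis c_i0 : forall j, c j i0.
Hypothesis repX : forall i, nc i -> rep i \in X.
Hypothesis c_rep : forall i j, nc i -> c j (rep i) = c j i.
Hypothesis c_X : {in X &, forall x y, c x y = (x == y)}.
Hypothesis X_gt1 : (1 < #|X|)%N.

(** A central index commutes with every element of [X], while two distinct
    elements of [X] do not commute. *)
Lemma transversal_nc x : x \in X -> nc x.
Proof.
move=> xX; have /card_gt0P[y] : (0 < #|X :\ x|)%N.
  by move: X_gt1; rewrite (cardsD1 x) xX.
rewrite !inE => /andP[yx yX]; apply/forallPn; exists y.
by rewrite c_X.
Qed.

Lemma transversalE x i : x \in X -> nc i -> c x i = (x == rep i).
Proof. by move=> xX nci; rewrite -c_rep // c_X // repX. Qed.

Lemma transversal_row_sum i :
  coord_sum X (row i C) = if nc i then 1 else #|X|%:Z.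
Proof.
rewrite /coord_sum; under eq_bigr do rewrite !mxE c_sym.
case: ifP => [nci | /negbFE/forallP ci].
  rewrite (bigD1 (rep i)) ?repX //= transversalE ?repX ?eqxx // big1 ?addr0 //.
  by move=> x /andP[xX xr]; rewrite transversalE // (negPf xr).
by under eq_bigr do rewrite ci; rewrite sumr_const -natz.
Qed.

(** A row of a central index has coordinate sum [#|X|], any other one has 1,
    and the difference is the modulus.  Conversely the row at [x] minus the row
    at [i0] is minus the sum of the indicators of the other classes; if the
    coordinate sum of [v] is [q * (#|X| - 1)], the coefficients [v 0 x - q] sum
    to [- q], and combining these differences with them gives back [v]. *)
Lemma transversal_spanP v :
  inIntSpan diffs v <->
  v \in class_rows nc rep /\ ((#|X| - 1)%N %| coord_sum X v)%Z.
Proof.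
set n := (#|X| - 1)%N; have [S0 linS] := class_rows_submod nc rep.
have nE : #|X|%:Z = n%:Z + 1 by rewrite -PoszD subnK // ltnW.
split=> [/inIntSpan_tuple[a ->] | [/class_rowsP vE /dvdzP[q vq]]].
  elim/big_ind: _ => [|u w [Su du] [Sw dw]|i _].
  - by rewrite raddf0 dvdz0.
  - by rewrite -[u]scale1r linS // scale1r raddfD rpredD.
  have /codomP[[g h] /= ->] : tnth diffs i \in diffs by apply: mem_tnth.
  rewrite -scaler_int intz; split.
    rewrite -[_ *: _]addr0 linS //; apply/class_rowsP => j; rewrite !mxE.
    case: ifP => [ncj | /negbFE/forallP cj]; first by rewrite !c_rep.
    by rewrite !cj subrr.
  rewrite scalarZ raddfB /= !transversal_row_sum dvdz_mull //.
  do 2!case: ifP => _; rewrite ?nE ?subrr ?dvdz0 // ?addrK ?dvdzz //.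
  by rewrite opprD addrC subrK rpredN dvdzz.
suff -> : v = \sum_(x in X) (row x C - row i0 C) *~ (v 0 x - q).
  elim/big_ind: _ => [|u w|x _]; [exact: inIntSpan0 | exact: inIntSpanD |].
  by apply: inIntSpan_mulz; apply/codomP; exists (x, i0).
apply/rowP => i; rewrite summxE vE.
have entry x : ((row x C - row i0 C) *~ (v 0 x - q)) 0 i =
    (v 0 x - q) * ((c x i)%:R - 1).
  by rewrite -scaler_int intz !mxE [c i0 i]c_sym c_i0.
under eq_bigr do rewrite entry.
case: ifP => [nci | /negbFE/forallP ci]; last first.
  by rewrite big1 // => x _; rewrite ci subrr mulr0.
rewrite (eq_bigr (fun x => (v 0 x - q) * (x == rep i)%:R - v 0 x + q)); last first.
  by move=> x xX; rewrite transversalE // mulrBr mulr1 opprB addrA addrAC.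
rewrite big_split sumrB /= -/(coord_sum X v) vq sumr_const.
rewrite (bigD1 (rep i)) ?repX //= eqxx mulr1 big1 ?addr0; last first.
  by move=> x /andP[_ /negPf ->]; rewrite mulr0.
have -> : q *+ #|X| = q * n%:Z + q.
  by rewrite -mulr_natr natz nE mulrDr mulr1.
by rewrite addrA subrK subrK.
Qed.

Lemma transversal_smith m (A : 'M[int]_(m, N)) d :
  rows_generate A (inIntSpan diffs) -> smith_entries A d ->
  exists r, d = rcons (nseq r 1%N) (#|X| - 1)%N.
Proof.
have /card_gt0P[x xX] := ltnW X_gt1.
(* The indicator of one class has coordinate sum 1. *)
pose e : 'rV[int]_N := \row_i (nc i && c x i)%:R.
apply: (cyclic_quotient_smith (S := class_rows nc rep)
                              (phi := coord_sum X) (e := e)).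
- exact: class_rows_submod.
- exact: class_rows_pure.
- apply/class_rowsP => i; rewrite !mxE; case: ifP => //= nci.
  by rewrite c_rep // transversal_nc ?repX.
- rewrite /= /coord_sum (bigD1 x) //= big1 => [|y /andP[yX yx]].
    by rewrite mxE transversal_nc // c_X // eqxx addr0.
  by rewrite mxE c_X // [x == y]eq_sym (negPf yx) andbF.
- by rewrite subn_gt0.
- exact: transversal_spanP.
Qed.

End Transversal.

(** * Centralizers in CA-groups *)

Section CAGroup.

Local Open Scope group_scope.

Variables (gT : finGroupType) (G : {group gT}).
Hypotheses (nabG : ~~ abelian G) (caG : CA_group G).

Local Notation noncentral := (G :\: 'Z(G)).
Local Notation commuteb x y := (x * y == y * x).
Local Notation C x := 'C_G[x]%G.

Lemma noncentralP x :
  reflect (x \in G /\ exists2 y, y \in G & ~~ commuteb x y) (x \in noncentral).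
Proof.
rewrite !inE; apply: (iffP andP) => [[nz xG]|[xG [y yG nc]]]; split => //.
  move: nz; rewrite xG /= => /centP nc; apply/exists_inP.
  apply: contraPT xG; rewrite negb_exists_in => /forall_inP c _; apply: nc => y yG.
  by apply/eqP/negbNE/c.
by apply: contra nc; rewrite xG /= => /centP/(_ y yG) c; apply/eqP.
Qed.

Lemma CA_cent_abelian x : x \in noncentral -> abelian 'C_G[x].
Proof. by move/forall_inP: caG; apply. Qed.

(** Everything commuting with [x] commutes with [y], as both lie in the abelian
    group ['C_G[x]]; so commuting is transitive on non-central elements. *)
Lemma CA_cent_eq x y :
  x \in noncentral -> y \in noncentral -> commute x y -> C x = C y.
Proof.
have sub a b : a \in noncentral -> b \in noncentral -> commute a b ->
    'C_G[a] \subset 'C_G[b].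
  move=> na nb cab; apply/subsetP => z za.
  have bC : b \in 'C_G[a].
    by apply/subcent1P; split=> //; case/setDP: nb.
  have /centsP/(_ _ bC _ za) cbz := CA_cent_abelian na.
  by apply/subcent1P; split=> //; case/subcent1P: za.
move=> nx ny cxy; apply: group_inj; apply/eqP.
by rewrite /= eqEsubset !sub.
Qed.

(** An abelian group containing a non-central [x] is inside ['C_G[x]], which is
    abelian.  A maximal abelian subgroup has such an element: if all of it were
    central, then adjoining any element of [G] would keep it abelian, so it would
    already contain [G], and [G] would be abelian. *)
Lemma CA_max_abelian : max_abelian_subgroups G = [set C x | x in noncentral].
Proof.
apply/setP => A; rewrite inE; apply/idP/imsetP => [|[x nx ->]]; last first.
  apply/maxgroupP; split=> [|H /andP[HG abH] CH].
    by rewrite subsetIl CA_cent_abelian.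
  apply/eqP; rewrite eqEsubset CH andbT /= subsetI HG /=.
  have xH : x \in H by apply: (subsetP CH); case/setDP: nx => *; apply/subcent1P.
  by apply/subsetP => y yH; apply/cent1P/esym; apply: (centsP abH).
case/maxgroupP=> /andP[AG abA] maxA.
have [x xA nx] : exists2 x, x \in A & x \in noncentral.
  apply/exists_inP; apply: contraR nabG; rewrite negb_exists_in => /forall_inP cA.
  have AZ : A \subset 'Z(G).
    by apply/subsetP => x xA; move: (cA x xA); rewrite inE (subsetP AG) // andbT negbK.
  apply/centsP => x xG y yG.
  have H : A <*> <[x]> = A.
    apply: (maxA (A <*> <[x]>)%G); last by rewrite joing_subl.
    rewrite join_subG AG cycle_subG xG abelianY abA cycle_abelian /=.
    rewrite centsC; apply: (subset_trans AZ).
    by rewrite subIset // orbC centS ?cycle_subG.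
  have : x \in A by rewrite -H mem_gen // inE cycle_id orbT.
  by move/(subsetP AZ)/setIP => [_ /centP]; apply.
exists x => //; apply: group_inj; apply/esym; apply: maxA.
  by rewrite subsetIl CA_cent_abelian.
rewrite subsetI AG; apply/subsetP => y yA; apply/cent1P.
by apply: (centsP abA).
Qed.

(** If [x] and [y] do not commute, no two of [x], [y], [x * y] do, so these have
    distinct centralizers. *)
Lemma CA_three_centralizers : (2 < #|max_abelian_subgroups G|)%N.
Proof.
have [x xG [y yG cxy]] :
    exists2 x, x \in G & exists2 y, y \in G & ~~ commuteb x y.
  move: nabG; rewrite /abelian => /subsetPn[x xG /centP nc].
  exists x => //; apply/exists_inP; apply: contraPT xG; rewrite negb_exists_in.
  by move=> /forall_inP c _; apply: nc => y yG; apply/eqP/negbNE/c.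
have ncE a b : a \in G -> b \in G -> ~~ commuteb a b -> C a != C b.
  move=> aG bG; apply: contra => /eqP Cab; apply/eqP.
  have /subcent1P[_ cba] : a \in C b by rewrite -Cab; apply/subcent1P.
  by apply: commute_sym.
have nC a b : a \in G -> b \in G -> ~~ commuteb a b -> a \in noncentral.
  by move=> aG bG nab; apply/noncentralP; split=> //; exists b.
have cyx : ~~ commuteb y x by apply: contra cxy => /eqP cyx; apply/eqP.
have xyG : (x * y) \in G by rewrite groupM.
have cxxy : ~~ commuteb x (x * y).
  apply: contra cxy => /eqP; rewrite /commute -mulgA => /mulgI c.
  by apply/eqP.
have cyxy : ~~ commuteb y (x * y).
  apply: contra cyx => /eqP; rewrite /commute mulgA => /mulIg c.
  by apply/eqP.
have sub : [set C x; C y; C (x * y)] \subset max_abelian_subgroups G.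
  rewrite CA_max_abelian; apply/subsetP => A; rewrite !inE -orbA.
  case/or3P=> /eqP ->; apply: imset_f; [exact: nC cxy | exact: nC cyx |].
  apply: (nC _ x) => //; apply: contra cxxy => /eqP c; exact/eqP.
apply: leq_trans (subset_leq_card sub).
rewrite setUC cardsU1 cards2 !inE negb_or.
by rewrite ![C (x * y) == _]eq_sym !ncE.
Qed.

End CAGroup.

(** The transversal consists of one non-central index in each maximal abelian
    subgroup; its cardinal is the number of those subgroups because a
    non-central element determines the one that contains it. *)
Lemma CA_lattice_smith (gT : finGroupType) (G : {group gT}) :
    ~~ abelian G -> CA_group G ->
  forall m (A : 'M[int]_(m, #|G|)) d,
    rows_generate A (comm_diff_lattice G) -> smith_entries A d ->
  exists r, d = rcons (nseq r 1%N) (#|max_abelian_subgroups G| - 1)%N.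
Proof.
move=> nabG caG; set MA := max_abelian_subgroups G.
pose c (i j : 'I_#|G|) := (enum_val i * enum_val j == enum_val j * enum_val i)%g.
pose i0 := enum_rank_in (group1 G) 1%g.
(* The default [i0] is never reached on a maximal abelian subgroup. *)
pose repA (A : {group gT}) := odflt i0 [pick i | enum_val i \in A :\: 'Z(G)%g].
pose rep (i : 'I_#|G|) := repA 'C_G[enum_val i]%G.
have ncE i : ~~ [forall j, c j i] = (enum_val i \in G :\: 'Z(G)%g).
  apply/forallPn/(noncentralP _ _) => [[j cji] | [xG [y yG nc]]].
    by split; [exact: enum_valP | exists (enum_val j); rewrite 1?eq_sym ?enum_valP].
  by exists (enum_rank_in yG y); rewrite /c enum_rankK_in // eq_sym.
have repAP x : x \in G :\: 'Z(G)%g ->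
    enum_val (repA 'C_G[x]%G) \in G :\: 'Z(G)%g /\
    'C_G[enum_val (repA 'C_G[x]%G)]%G = 'C_G[x]%G.
  move=> nx; have /setDP[xG xZ] := nx.
  rewrite /repA; case: pickP => [i /setDP[/= /subcent1P[iG cxi] iZ] | no] /=;
    last first.
    have := no (enum_rank_in xG x); rewrite /= enum_rankK_in //.
    by rewrite inE xZ /= => /subcent1P[]; split.
  have ni : enum_val i \in G :\: 'Z(G)%g by apply/setDP.
  by split=> //; apply: (CA_cent_eq caG) => //; apply: commute_sym.
have repA_inj : {in MA &, injective repA}.
  rewrite /MA CA_max_abelian // => _ _ /imsetP[x nx ->] /imsetP[y ny ->] eqr.
  by have [_ <-] := repAP x nx; have [_ <-] := repAP y ny; rewrite eqr.
have cardX : #|repA @: MA| = #|MA| by apply: card_in_imset.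
rewrite -cardX; apply: (transversal_smith (c := c) (i0 := i0) (rep := rep)).
- by move=> i j; rewrite /c eq_sym.
- by move=> j; rewrite /c enum_rankK_in ?group1 // mulg1 mul1g.
- move=> i; rewrite ncE => ni; apply: imset_f.
  by rewrite /MA CA_max_abelian //; apply: (imset_f (fun x => 'C_G[x]%G)).
- move=> i j; rewrite ncE => ni; have [_ eqC] := repAP _ ni.
  have cC k : c j k = (enum_val j \in 'C_G[enum_val k]%G).
    by apply/eqP/subcent1P => [ck | []//]; split; [exact: enum_valP|].
  by rewrite !cC eqC.
- move=> _ _ /imsetP[A MA_A ->] /imsetP[B MA_B ->].
  rewrite (inj_in_eq repA_inj) //; move: MA_A MA_B; rewrite /MA CA_max_abelian //.
  case/imsetP=> x nx -> /imsetP[y ny ->].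
  have [na eqa] := repAP x nx; have [nb eqb] := repAP y ny.
  rewrite -[X in _ = (X == _)]eqa -[X in _ = (_ == X)]eqb.
  apply/eqP/eqP => [|eqC]; first exact: (CA_cent_eq caG).
  have : enum_val (repA 'C_G[x]%G) \in 'C_G[enum_val (repA 'C_G[y]%G)]%G.
    by rewrite -eqC; apply/subcent1P; case/setDP: na.
  by case/subcent1P => _ /commute_sym.
- by rewrite cardX ltnW // CA_three_centralizers.
Qed.

Local Close Scope ring_scope.

Theorem theorem3p1 (gT : finGroupType) (G : {group gT}) (b : nat)
    (hG : ~~ abelian G) (hCA : CA_group G)
    (hb : b = #|max_abelian_subgroups G|) :
  [/\ exists d, invariant_factors (comm_diff_lattice G) d,
      forall d, invariant_factors (comm_diff_lattice G) d ->
        nontrivial_factors d = [:: b - 1] &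
      forall p, comm_conductor G p <-> p \in \pi(b - 1)].
Proof.
have b_gt2 : (2 < b)%N by rewrite hb CA_three_centralizers.
have smithM := CA_lattice_smith hG hCA; rewrite -hb in smithM.
have genM : exists m (A : 'M[int]_(m, #|G|)),
    rows_generate A (comm_diff_lattice G).
  by do 2!eexists; apply: rows_generate_inIntSpan.
split.
- have [m [A genA]] := genM; have [d smithA] := smith_entries_exist A.
  by exists d, m, A.
- move=> d [m [A [genA smithA]]]; have [r ->] := smithM _ _ _ genA smithA.
  by rewrite /nontrivial_factors filter_rcons filter_nseq ltn_subRL b_gt2.
- by apply: conductor_one_factor => //; rewrite subn_gt0 ltnW.
Qed.
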